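(* If $G$ is a connected $(P_5,C_4)$-free graph, then $\gamma_s(G) \le \max\{3,\alpha(G)\}$.
   Context: All graphs are finite, simple and undirected. $P_n$ and $C_n$ denote the path and the cycle on $n$ vertices. A graph is $(H_1,H_2)$-free if it has no induced subgraph isomorphic to $H_1$ or to $H_2$. A set $S\subseteq V(G)$ is a dominating set of $G$ if every vertex of $V(G)\setminus S$ is adjacent to at least one vertex of $S$. A secure dominating set of $G$ is a dominating set $S$ of $G$ such that for every $v\in V(G)\setminus S$ there is a neighbor $u$ of $v$ in $S$ such that $(S\setminus\{u\})\cup\{v\}$ is a dominating set of $G$. The secure domination number $\gamma_s(G)$ is the minimum cardinality of a secure dominating set of $G$, and the independence number $\alpha(G)$ is the maximum cardinality of an independent set of $G$. *)

(* Defs.v *)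
From mathcomp Require Import all_boot.

Set Implicit Arguments.
Unset Strict Implicit.
Unset Printing Implicit Defensive.

(* A finite simple graph is a symmetric irreflexive relation on a finType. *)

Definition path_rel (n : nat) : rel 'I_n :=
  fun i j => (i.+1 == j) || (j.+1 == i).

(* [ordS] is the cyclic successor on ['I_n]; this is the n-vertex cycle only
   for n >= 3. *)
Definition cycle_rel (n : nat) : rel 'I_n :=
  fun i j => (ordS i == j) || (ordS j == i).

Section Graph.

Variables (T : finType) (e : rel T).

Definition has_induced (U : finType) (h : rel U) : Prop :=
  exists f : U -> T, injective f /\ forall x y : U, e (f x) (f y) = h x y.

Definition connected_graph : Prop := forall x y : T, connect e x y.

Definition independent (S : {set T}) : bool :=
  [forall x in S, forall y in S, ~~ e x y].

Definition indep_number : nat := \max_(S : {set T} | independent S) #|S|.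

Definition dominating (S : {set T}) : bool :=
  [forall v in ~: S, exists u in S, e v u].

Definition secure_dominating (S : {set T}) : bool :=
  dominating S &&
  [forall v in ~: S, exists u in S, e v u && dominating (v |: (S :\ u))].

(* The value of the [arg min] is meaningful because the default [setT] is
   itself secure dominating: see [secure_dominatingT]. *)
Definition secure_dom_number : nat :=
  #|[arg min_(S < [set: T] | secure_dominating S) #|S|]|.

Lemma secure_dominatingT : secure_dominating [set: T].
Proof. by apply/andP; split; apply/forallP => v; rewrite setCT inE. Qed.

Lemma secure_dom_numberP :
  (exists2 S, secure_dominating S & #|S| = secure_dom_number) /\
  (forall S, secure_dominating S -> secure_dom_number <= #|S|).
Proof.
rewrite /secure_dom_number; case: arg_minnP => [|S sS minS].
  exact: secure_dominatingT.
by split; first exists S.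
Qed.

End Graph.

(* Main.v *)
Require Import Defs.
From mathcomp Require Import all_boot.

(** Start from a maximum independent set [S].  It dominates, and any [v] outside
    it that has a single neighbor [u] in [S] can replace [u]: two private
    neighbors of [u] are adjacent, as otherwise they could be exchanged for [u]
    to give a larger independent set ([private_clique]).  If some [v] cannot
    replace any of its neighbors in [S], each such neighbor [u] has a private
    neighbor that is not adjacent to [v]; two of these neighbors [u], [u'] and
    their private neighbors [p], [p'] form with [v] an induced P5 unless
    [u v u' p' p] is an induced C5, and a third neighbor in [S] would give an
    induced P5 ([undefended_pentagon]).

    In a (P5, C4)-free graph, C5 is very rigid: the closed neighborhood of any
    vertex meets an induced C5 in nothing, in three consecutive vertices, or in
    all five ([pentagon_trace]).  It follows that the pairs of neighbors in [S]
    of two undefended vertices are equal or disjoint ([undefended_nbrs_eq]).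

    If [S] is just one such pair, then [S] with [v] added is secure dominating and
    has 3 elements ([undefended_small]).  Otherwise connectivity provides, for each
    such pair, a hub: a vertex that dominates the closed neighborhoods of both
    members ([undefended_hub]).  One member of a pair can then be traded for a hub,
    after which all vertices around the pair are defended.  Pairs may share
    hubs, so the trade is made only along a minimal set of hubs
    that serves all pairs, and the size of [S] does not increase ([hubs_secure]). *)

Set Implicit Arguments.
Unset Strict Implicit.
Unset Printing Implicit Defensive.

Section SecureDomination.

Context (T : finType) (e : rel T).
Context (e_sym : symmetric e) (e_irr : irreflexive e).
Context (P5_free : ~ has_induced e (@path_rel 5)).
Context (C4_free : ~ has_induced e (@cycle_rel 4)).

(** * Forbidden paths and cycles *)

Definition cadj : rel T := fun x y => (x == y) || e x y.

Lemma cadj_sym : symmetric cadj.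
Proof. by move=> x y; rewrite /cadj eq_sym e_sym. Qed.

Lemma cadjxx x : cadj x x.
Proof. by rewrite /cadj eqxx. Qed.

Lemma edge_cadj x y : e x y -> cadj x y.
Proof. by rewrite /cadj orbC => ->. Qed.

(** Injectivity is automatic, because distinct vertices of P5 have distinct
    neighborhoods. *)
Lemma no_P5 a b c d f :
  e a b -> e b c -> e c d -> e d f ->
  e a c = false -> e a d = false -> e a f = false ->
  e b d = false -> e b f = false -> e c f = false -> False.
Proof.
move=> ab bc cd df ac ad af bd bf cf; apply: P5_free.
pose g (i : 'I_5) := nth a [:: a; b; c; d; f] i.
have gE x y : e (g x) (g y) = @path_rel 5 x y.
  case: x => [[|[|[|[|[|x]]]]] ltx] //; case: y => [[|[|[|[|[|y]]]]] lty] //;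
  by rewrite /g /path_rel /= ?e_irr ?[e b a]e_sym ?[e c a]e_sym ?[e d a]e_sym
    ?[e f a]e_sym ?[e c b]e_sym ?[e d b]e_sym ?[e f b]e_sym ?[e d c]e_sym
    ?[e f c]e_sym ?[e f d]e_sym ?ab ?bc ?cd ?df ?ac ?ad ?af ?bd ?bf ?cf.
exists g; split=> // x y gxy; apply/val_inj.
have h z : @path_rel 5 x z = @path_rel 5 y z by rewrite -!gE gxy.
have := h (@Ordinal 5 0 isT); have := h (@Ordinal 5 1 isT).
have := h (@Ordinal 5 3 isT); have := h (@Ordinal 5 4 isT).
rewrite /path_rel /=; case: x y {h gxy} => [x ltx] [y lty] /=.
by move: x y ltx lty => [|[|[|[|[|x]]]]] [|[|[|[|[|y]]]]].
Qed.

(** Opposite vertices of C4 have the same neighborhood, so one pair has to be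
    assumed distinct; the other yields the closed adjacency. *)
Lemma no_C4 a b c d :
  e a b -> e b c -> e c d -> e d a -> e b d = false -> b <> d -> cadj a c.
Proof.
move=> ab bc cd da bd neq_bd; rewrite /cadj.
case: eqVneq => //= neq_ac; apply/negPn/negP => /negbTE ac; apply: C4_free.
pose g (i : 'I_4) := nth a [:: a; b; c; d] i.
have gE x y : e (g x) (g y) = @cycle_rel 4 x y.
  case: x => [[|[|[|[|x]]]] ltx] //; case: y => [[|[|[|[|y]]]] lty] //;
  by rewrite /g /cycle_rel -!val_eqE /= ?e_irr ?[e b a]e_sym ?[e c a]e_sym
    ?[e a d]e_sym ?[e c b]e_sym ?[e d b]e_sym ?[e d c]e_sym
    ?ab ?bc ?cd ?da ?ac ?bd.
have ne x y : e x y -> x <> y by move=> exy xy; rewrite xy e_irr in exy.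
have neq_ac' : a <> c by apply/eqP.
exists g; split=> // x y; move: x y.
case=> [[|[|[|[|x]]]] ltx] //; case=> [[|[|[|[|y]]]] lty] //;
  rewrite /g /= => eqxy; first [ by apply/val_inj | exfalso];
  by [ case: (ne _ _ ab) | case: (ne _ _ bc) | case: (ne _ _ cd)
     | case: (ne _ _ da) | case: neq_bd | case: neq_ac' ].
Qed.

(** * Vertices around an induced C5 *)

Definition pentagon a b c d f : bool :=
  [&& e a b, e b c, e c d, e d f & e f a] &&
  [&& ~~ e a c, ~~ e b d, ~~ e c f, ~~ e d a & ~~ e f b].

Lemma pentagon_rot a b c d f : pentagon a b c d f -> pentagon b c d f a.
Proof.
case/andP=> /and5P[ab bc cd df fa] /and5P[ac bd cf da fb].
by rewrite /pentagon ab bc cd df fa bd cf da fb ac.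
Qed.

Lemma pentagon_rev a b c d f : pentagon a b c d f -> pentagon c b a f d.
Proof.
case/andP=> /and5P[ab bc cd df fa] /and5P[ac bd cf da fb].
by apply/andP; split; apply/and5P; split; rewrite // e_sym.
Qed.

Lemma pentagon_neq a b c d f : pentagon a b c d f -> a != c.
Proof.
case/andP=> /and5P[_ _ cd _ _] /and5P[_ _ _ da _].
by apply: contraNneq da => ->; rewrite e_sym.
Qed.

Lemma pentagonE a b c d f : pentagon a b c d f ->
  [seq cadj a z | z <- [:: a; b; c; d; f]] = [:: true; true; false; false; true].
Proof.
move=> P; case/andP: (P) => /and5P[ab bc cd df fa] /and5P[ac bd cf da fb].
rewrite /cadj /= eqxx ab [e a f]e_sym fa [e a d]e_sym (negbTE da) (negbTE ac).
rewrite !orbT !orbF.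
rewrite (negbTE (pentagon_neq P)).
have -> // : a == d = false by apply: contraNF ac => /eqP->; rewrite e_sym.
Qed.

Definition arcs : seq (seq bool) :=
  [:: [:: true; true; false; false; true]; [:: true; true; true; false; false];
      [:: false; true; true; true; false]; [:: false; false; true; true; true];
      [:: true; false; false; true; true]].

Lemma no_trace1 a b c d f y : pentagon a b c d f ->
  e y a -> e y b = false -> e y c = false -> e y d = false -> False.
Proof.
case/andP=> /and5P[ab bc cd df fa] /and5P[ac bd cf da fb] ya yb yc yd.
apply: (@no_P5 y a b c d) => //; try exact/negbTE.
by rewrite e_sym; apply/negbTE.
Qed.

Lemma no_trace2 a b c d f y : pentagon a b c d f -> y <> b ->
  e y a -> e y b = false -> e y c -> False.
Proof.
case/andP=> /and5P[ab bc cd df fa] /and5P[ac bd cf da fb] nyb ya yb yc.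
have : cadj a c.
  by apply: (@no_C4 a b c y) => //; [rewrite e_sym | rewrite e_sym | exact/nesym].
rewrite /cadj (negbTE ac) orbF => /eqP eac.
by rewrite -eac e_sym (negbTE da) in cd.
Qed.

(** Any other trace contains, up to rotation, one vertex followed by three
    missed ones, which give with [y] an induced P5, or two vertices with their
    common neighbor missed, which give with [y] an induced C4.  Closed adjacency makes the
    statement cover the vertices of the pentagon itself. *)
Lemma pentagon_trace a b c d f y : pentagon a b c d f ->
  let t := [seq cadj y z | z <- [:: a; b; c; d; f]] in
  [\/ t = nseq 5 false, t \in arcs | t = nseq 5 true].
Proof.
move=> P1 t.
have P2 := pentagon_rot P1; have P3 := pentagon_rot P2.
have P4 := pentagon_rot P3; have P5 := pentagon_rot P4.
rewrite {}/t.
have [->|/eqP nya] := eqVneq y a.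
  by apply: Or32; rewrite (pentagonE P1).
have [->|/eqP nyb] := eqVneq y b.
  by apply: Or32; case: (pentagonE P2) => /= -> -> -> -> ->.
have [->|/eqP nyc] := eqVneq y c.
  by apply: Or32; case: (pentagonE P3) => /= -> -> -> -> ->.
have [->|/eqP nyd] := eqVneq y d.
  by apply: Or32; case: (pentagonE P4) => /= -> -> -> -> ->.
have [->|/eqP nyf] := eqVneq y f.
  by apply: Or32; case: (pentagonE P5) => /= -> -> -> -> ->.
have cE z : y <> z -> cadj y z = e y z by move/eqP/negbTE; rewrite /cadj => ->.
rewrite /= !cE //.
case ya: (e y a); case yb: (e y b); case yc: (e y c); case yd: (e y d);
case yf: (e y f); try (by apply: Or31); try (by apply: Or32);
  try (by apply: Or33); exfalso.
all: first [ by apply: (no_trace1 P1 (y := y)) | by apply: (no_trace1 P2 (y := y))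
  | by apply: (no_trace1 P3 (y := y))
  | by apply: (no_trace1 P4 (y := y)) | by apply: (no_trace1 P5 (y := y))
  | by apply: (no_trace2 P1 (y := y)) | by apply: (no_trace2 P2 (y := y))
  | by apply: (no_trace2 P3 (y := y))
  | by apply: (no_trace2 P4 (y := y)) | by apply: (no_trace2 P5 (y := y)) ].
Qed.

Definition far_from z (C : seq T) := [seq cadj z x | x <- C] = nseq (size C) false.
Definition complete_to z (C : seq T) := [seq cadj z x | x <- C] = nseq (size C) true.

Lemma no_far_arc a b c d f w z : pentagon a b c d f -> e w z ->
  cadj w b -> cadj w c = false -> cadj w d = false ->
  cadj z b = false -> cadj z c = false -> cadj z d = false -> False.
Proof.
case/andP=> /and5P[ab bc cd df fa] /and5P[ac bd cf da fb] wz wb wc wd zb zc zd.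
have open x y : cadj x y = false -> e x y = false.
  by apply: contraFF; apply: edge_cadj.
apply: (@no_P5 z w b c d) => //; try exact: open; try exact/negbTE.
  by rewrite e_sym.
case/orP: wb => // /eqP wb.
by rewrite wb edge_cadj in wc.
Qed.

(** If the trace of [w] were an arc, [w] could replace the middle of the arc
    in the pentagon, and [z] would see exactly one vertex of the new pentagon. *)
Lemma far_neighbor a b c d f w z : pentagon a b c d f -> e w z ->
  far_from z [:: a; b; c; d; f] ->
  far_from w [:: a; b; c; d; f] \/ complete_to w [:: a; b; c; d; f].
Proof.
move=> P1 wz [za zb zc zd zf].
have P2 := pentagon_rot P1; have P3 := pentagon_rot P2.
have P4 := pentagon_rot P3; have P5 := pentagon_rot P4.
case: (pentagon_trace w P1) => [|wC|]; [by left | exfalso | by right].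
move: wC; rewrite !inE => /orP[|/orP[|/orP[|/orP[]]]] /eqP[wa wb wc wd wf].
- exact: (no_far_arc P1 wz).
- exact: (no_far_arc P2 wz).
- exact: (no_far_arc P3 wz).
- exact: (no_far_arc P4 wz).
- exact: (no_far_arc P5 wz).
Qed.

Lemma complete_cadj2 a b c d f k y : pentagon a b c d f ->
  cadj k a -> cadj k c -> cadj y a -> cadj y c -> cadj y k.
Proof.
move=> P; have neq_ac := pentagon_neq P.
case/andP: P => _ /and5P[ac _ _ _ _] ka kc.
have nac : cadj a c = false by rewrite /cadj (negbTE ac) orbF; apply/negbTE.
have eka : e k a by case/orP: ka kc => // /eqP->; rewrite nac.
have ekc : e k c by case/orP: kc ka => // /eqP->; rewrite cadj_sym nac.
case/orP=> [/eqP-> _|ya]; first by rewrite edge_cadj // e_sym.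
case/orP=> [/eqP->|yc]; first by rewrite edge_cadj // e_sym.
by apply: (@no_C4 y a k c) => //;
  [rewrite e_sym | rewrite e_sym | exact/negbTE | exact/eqP].
Qed.

(** A nonempty trace contains two nonadjacent vertices of the pentagon, and these
    span a C4 with [k] and [y] unless [k] and [y] are adjacent. *)
Lemma complete_dominates a b c d f k y : pentagon a b c d f ->
  complete_to k [:: a; b; c; d; f] -> ~ far_from y [:: a; b; c; d; f] ->
  cadj y k.
Proof.
move=> P1 [ka kb kc kd kf].
have P2 := pentagon_rot P1; have P3 := pentagon_rot P2.
have P4 := pentagon_rot P3; have P5 := pentagon_rot P4.
case: (pentagon_trace y P1) => [//|+ _|[ya yb yc yd yf] _]; last first.
  exact: (complete_cadj2 P1).
rewrite !inE => /orP[|/orP[|/orP[|/orP[]]]] /eqP[ya yb yc yd yf].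
- exact: (complete_cadj2 P5).
- exact: (complete_cadj2 P1).
- exact: (complete_cadj2 P2).
- exact: (complete_cadj2 P3).
- exact: (complete_cadj2 P4).
Qed.

(** Every arc of three consecutive vertices meets a given pair of nonadjacent
    ones. *)
Lemma far_from2 a b c d f y : pentagon a b c d f ->
  cadj y a = false -> cadj y c = false -> far_from y [:: a; b; c; d; f].
Proof.
move=> P ya yc; case: (pentagon_trace y P) => //; last by case; rewrite ya.
by rewrite !inE => /orP[|/orP[|/orP[|/orP[]]]] /eqP[]; rewrite ya yc.
Qed.

(** The two possible arcs are [b c d] and [c d f]: vertices with equal arcs are
    adjacent because C4 is excluded, the others because P5 is. *)
Lemma pentagon_private_clique a b c d f x y : pentagon a b c d f ->
  cadj x c -> cadj x a = false -> cadj y c -> cadj y a = false -> cadj x y.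
Proof.
move=> P xc xa yc ya; case/andP: (P) => /and5P[ab bc cd df fa] /and5P[ac bd cf da fb].
have arc z : cadj z c -> cadj z a = false ->
    [seq cadj z w | w <- [:: a; b; c; d; f]] = [:: false; true; true; true; false] \/
    [seq cadj z w | w <- [:: a; b; c; d; f]] = [:: false; false; true; true; true].
  move=> zc za; case: (pentagon_trace z P) => [[_ _]|zC|[]]; rewrite ?zc ?za //.
  by move: zC; rewrite !inE => /orP[|/orP[|/orP[|/orP[]]]] /eqP; auto;
    case; rewrite ?zc ?za.
have P2 := pentagon_rot P; have P3 := pentagon_rot P2.
suff mixed x' y' : cadj x' b -> cadj x' c -> cadj x' d -> cadj x' a = false ->
    cadj x' f = false ->
    cadj y' c -> cadj y' d -> cadj y' f -> cadj y' a = false ->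
    cadj y' b = false -> cadj x' y'.
  case: (arc x xc xa) (arc y yc ya) => [[_ xb _ xd xf]|[_ xb _ xd xf]]
    [[_ yb _ yd yf]|[_ yb _ yd yf]].
  - exact: (complete_cadj2 P2).
  - exact: mixed.
  - by rewrite cadj_sym; apply: mixed.
  - exact: (complete_cadj2 P3).
move=> {x y xc xa yc ya arc} xb xc xd xa xf yc yd yf ya yb.
have open x y : cadj x y = false -> e x y = false.
  by apply: contraFF; apply: edge_cadj.
apply/negPn/negP => /negbTE xy.
(* Nonadjacent [x'], which sees [b], and [y'], which sees [f], would be the
   ends of an induced P5 through [b a f]. *)
apply: (@no_P5 x' b a f y') => //; try exact: open; try exact/negbTE.
- by case/orP: xb xa => // /eqP->; rewrite cadj_sym edge_cadj.
- by rewrite e_sym.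
- by rewrite e_sym.
- by case/orP: yf ya => [/eqP->|]; [rewrite edge_cadj | rewrite e_sym].
- by rewrite e_sym; apply/negbTE.
- by rewrite e_sym; apply: open.
- by rewrite e_sym; apply: open.
Qed.

(** * Undefended vertices of a maximum independent set *)

Lemma dominatingP (S : {set T}) :
  reflect (forall y, exists2 s, s \in S & cadj y s) (dominating e S).
Proof.
apply: (iffP forall_inP) => [domS y|domS y].
  have [yS|yS] := boolP (y \in S); first by exists y; rewrite ?cadjxx.
  by have /exists_inP[s sS ys] := domS y (etrans (in_setC _ _) yS);
    exists s; rewrite ?edge_cadj.
rewrite inE => yS; have [s sS] := domS y.
case/orP=> [/eqP eys|ys]; first by rewrite eys sS in yS.
by apply/exists_inP; exists s.
Qed.

Definition defended (S : {set T}) v :=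
  [exists u in S, e v u && dominating e (v |: (S :\ u))].

Lemma secure_dominatingP (S : {set T}) : dominating e S ->
  (forall v, v \notin S -> defended S v) -> secure_dominating e S.
Proof.
move=> domS defS; apply/andP; split=> //.
by apply/forall_inP => v; rewrite inE => /defS.
Qed.

Lemma defendedP (S : {set T}) v u : u \in S -> e v u ->
  (forall y, exists2 s, s \in v |: (S :\ u) & cadj y s) -> defended S v.
Proof. by move=> uS vu /dominatingP domS; apply/exists_inP; exists u; rewrite ?vu. Qed.

Lemma secure_dom_number_le (S : {set T}) n :
  secure_dominating e S -> #|S| <= n -> secure_dom_number e <= n.
Proof. by case: (secure_dom_numberP e) => _ minS /minS /leq_trans; apply. Qed.

Context (S : {set T}).
Context (indepS : independent e S).
Context (maxS : forall A : {set T}, independent e A -> #|A| <= #|S|).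

Lemma indep_edge u v : u \in S -> v \in S -> e u v = false.
Proof.
move=> uS vS; apply/negbTE.
by move/forall_inP/(_ u uS)/forall_inP: indepS; apply.
Qed.

Lemma indep_cadj u v : u \in S -> v \in S -> cadj u v = (u == v).
Proof. by move=> uS vS; rewrite /cadj indep_edge // orbF. Qed.

Lemma independentU1 (A : {set T}) x : independent e A ->
  (forall y, y \in A -> e x y = false) -> independent e (x |: A).
Proof.
move=> indA xA; apply/forall_inP => y /setU1P[->|yA];
  apply/forall_inP => z /setU1P[->|zA].
- by rewrite e_irr.
- by rewrite xA.
- by rewrite e_sym xA.
- by move/forall_inP/(_ y yA)/forall_inP: indA; apply.
Qed.

Lemma max_indep_dominating : dominating e S.
Proof.
apply/dominatingP => y; apply/exists_inP; apply: contraT => /exists_inPn far_y.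
have yS : y \notin S by apply/negP => /far_y; rewrite cadjxx.
have /maxS: independent e (y |: S).
  by apply: independentU1 => // z /far_y; apply: contraNF; apply: edge_cadj.
by rewrite cardsU1 yS ltnn.
Qed.

Definition nbrs v := [set u in S | e v u].

Lemma nbrsP u v : reflect (u \in S /\ e v u) (u \in nbrs v).
Proof. by rewrite inE; apply: andP. Qed.

(** Two nonadjacent private neighbors exchanged for [u] would enlarge [S]. *)
Lemma private_clique u v w : u \in S ->
  nbrs v \subset [set u] -> nbrs w \subset [set u] -> v \notin S -> w \notin S ->
  cadj v w.
Proof.
move=> uS vu wu vS wS; apply/negPn/negP => nvw.
have out x : nbrs x \subset [set u] -> forall y, y \in S :\ u -> e x y = false.
  move=> xu y /setD1P[nyu yS]; apply: contraNF nyu => xy.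
  by rewrite -in_set1 (subsetP xu) // inE yS.
have /maxS: independent e (v |: (w |: (S :\ u))).
  apply: independentU1 => [|y /setU1P[->|]]; last exact: out.
    apply: independentU1 => [|y]; last exact: out.
    apply/forall_inP => y /setD1P[_ yS]; apply/forall_inP => z /setD1P[_ zS].
    by rewrite indep_edge.
  by apply: contraNF nvw; apply: edge_cadj.
rewrite !cardsU1 !inE (negbTE vS) (negbTE wS) !andbF !orbF.
have -> /= : v != w by apply: contraNneq nvw => ->; rewrite cadjxx.
by rewrite addnA [#|S|](cardsD1 u) uS ltnn.
Qed.

Definition undefended v := (v \notin S) && ~~ defended S v.

(** A vertex that stops being dominated when [v] replaces [u] must be a private
    neighbor of [u], because [S] dominates. *)
Lemma undefended_private v u : undefended v -> u \in nbrs v ->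
  exists p, [/\ p \notin S, nbrs p = [set u] & cadj v p = false].
Proof.
case/andP=> vS /exists_inPn undef; rewrite inE => /andP[uS vu].
have := undef u uS; rewrite vu /= => ndom.
have /existsP[p /forall_inP far_p] :
    [exists p, forall s in v |: (S :\ u), ~~ cadj p s].
  apply: contraT => /existsPn near; case/dominatingP: ndom => p.
  by have /forall_inPn[s sS /negPn ps] := near p; exists s.
have pv : cadj v p = false by rewrite cadj_sym; apply/negbTE/far_p/setU11.
have p_far s : s \in S -> s != u -> cadj p s = false.
  by move=> sS nsu; apply/negbTE/far_p; rewrite !inE nsu sS orbT.
have npu : p != u by apply: contraFneq pv => ->; apply: edge_cadj.
have pS : p \notin S by apply/negP => pS; move: (p_far p pS npu); rewrite cadjxx.
exists p; split=> //; apply/setP => s; rewrite !inE.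
have [sS|sS] /= := boolP (s \in S); last by apply/esym; apply: contraNF sS => /eqP->.
have [->|nsu] := eqVneq s u; last by apply: contraFF (p_far s sS nsu); apply: edge_cadj.
have /dominatingP/(_ p)[s' s'S ps'] := max_indep_dominating.
have [eqs'|nsu] := eqVneq s' u; last by rewrite p_far in ps'.
by case/orP: ps'; rewrite eqs' // => /eqP epu; rewrite epu eqxx in npu.
Qed.

(** By [private_clique] the private neighbor [p] of [u] forces a second neighbor
    [u'], with its own [p'].  The path [p u v u' p'] must close into a C5, and a
    third neighbor of [v] in [S] would begin an induced P5 through [v u p p']. *)
Lemma undefended_pentagon v u : undefended v -> u \in nbrs v ->
  exists u' p' p, pentagon u v u' p' p /\ nbrs v = [set u; u'].
Proof.
move=> undef_v uv; have [p [pS up vp]] := undefended_private undef_v uv.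
have /nbrsP[uS vu] := uv.
have vS : v \notin S by case/andP: undef_v.
have [u' u'v nu'u] : exists2 u', u' \in nbrs v & u' \notin [set u].
  by apply/subsetPn; apply: contraFN vp => vu1; apply: (private_clique uS); rewrite // up.
have [p' [p'S up' vp']] := undefended_private undef_v u'v.
have /nbrsP[u'S vu'] := u'v.
rewrite inE in nu'u.
have nbE x w s : nbrs x = [set w] -> s \in S -> e x s = (s == w).
  by move=> /setP/(_ s); rewrite !inE => + sS; rewrite sS.
have open x y : cadj x y = false -> e x y = false.
  by apply: contraFF; apply: edge_cadj.
have pu' : e p u' = false by rewrite (nbE _ _ _ up) // (negbTE nu'u).
have p'u : e p' u = false by rewrite (nbE _ _ _ up') // eq_sym (negbTE nu'u).
have pu : e p u by rewrite (nbE _ _ _ up).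
have p'u' : e p' u' by rewrite (nbE _ _ _ up').
have pp' : e p p'.
  apply/negPn/negP => /negbTE npp'.
  apply: (@no_P5 p u v u' p') => //; rewrite 1?[e u v]e_sym 1?[e u' p']e_sym //.
  - by rewrite e_sym open.
  - exact: indep_edge.
  - by rewrite e_sym.
  - exact: open.
have P : pentagon u v u' p' p.
  have sym x y : e x y = false -> ~~ e y x by rewrite e_sym => ->.
  apply/andP; split; apply/and5P; split; rewrite //.
  - by rewrite e_sym.
  - by rewrite e_sym.
  - by rewrite e_sym.
  - by rewrite indep_edge.
  - by rewrite open.
  - exact: sym.
  - by rewrite p'u.
  - by apply: sym; apply: open.
exists u', p', p; split=> //; apply/eqP; rewrite eqEsubset; apply/andP; split.
  apply/subsetP => w; rewrite inE => /andP[wS vw]; rewrite !inE.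
  apply/negPn/negP; rewrite negb_or => /andP[nwu nwu'].
  apply: (@no_P5 w v u p p') => //; try exact: open.
  - by rewrite e_sym.
  - by rewrite e_sym.
  - exact: indep_edge.
  - by rewrite e_sym (nbE _ _ _ up) // (negbTE nwu).
  - by rewrite e_sym (nbE _ _ _ up') // (negbTE nwu').
  - by rewrite e_sym.
by rewrite subUset !sub1set uv u'v.
Qed.

(** The second neighbor [u2] of [w] in [S] is far from the pentagon of [v]
    when it differs from [u'], so [w], which sees [u], is complete to that
    pentagon and would have the three neighbors [u], [u'] and [u2] in [S]. *)
Lemma undefended_nbrs_eq v w u : undefended v -> undefended w ->
  u \in nbrs v -> u \in nbrs w -> nbrs v = nbrs w.
Proof.
move=> undef_v undef_w uv uw.
have [u' [p' [p [P nv]]]] := undefended_pentagon undef_v uv.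
have [u2 [q' [q [Q nw]]]] := undefended_pentagon undef_w uw.
have [/nbrsP[uS vu] /nbrsP[_ wu]] := (uv, uw).
have /nbrsP[u2S wu2] : u2 \in nbrs w by rewrite nw set22.
have /nbrsP[u'S vu'] : u' \in nbrs v by rewrite nv set22.
have nw' x : x \in S -> e w x = (x \in [set u; u2]).
  by move=> xS; rewrite -nw inE xS.
have [eq2|n2] := eqVneq u2 u'; first by rewrite nv nw eq2.
have nuu2 : u2 != u by rewrite eq_sym (pentagon_neq Q).
have nuu' : u' != u by rewrite eq_sym (pentagon_neq P).
have u2far : far_from u2 [:: u; v; u'; p'; p].
  by apply: far_from2 => //; rewrite indep_cadj //; apply: negbTE.
case: (far_neighbor P wu2 u2far) => [[wu'] | [_ _ wu' _ _]].
  by rewrite edge_cadj in wu'.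
have wS : w \notin S by case/andP: undef_w.
case/orP: wu' => [/eqP ewu'|]; first by rewrite ewu' u'S in wS.
by rewrite nw' // !inE (negbTE nuu') eq_sym (negbTE n2).
Qed.

Lemma undefended_nbr v : undefended v -> exists u, u \in nbrs v.
Proof.
case/andP=> vS _; have /dominatingP/(_ v)[u uS] := max_indep_dominating.
case/orP=> [/eqP evu|vu]; first by rewrite evu uS in vS.
by exists u; apply/nbrsP.
Qed.

(** * Securing the set *)

(** The set [v |: S] is secure.  A vertex [x] that sees both members of [S]
    also sees [v], and replacing [v] leaves [S].  A vertex [x] that sees only the
    member [c] replaces [c], because the vertices that only [c] dominates are
    adjacent to [x] by [pentagon_private_clique]. *)
Lemma undefended_small v : undefended v -> S \subset nbrs v -> secure_dom_number e <= 3.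
Proof.
move=> undef_v subS; have [u uv] := undefended_nbr undef_v.
have [u' [p' [p [P nv]]]] := undefended_pentagon undef_v uv.
have eqS : S = [set u; u'].
  by rewrite -nv; apply/eqP; rewrite eqEsubset subS; apply/subsetP=> x /nbrsP[].
have vS : v \notin S by case/andP: undef_v.
have [/nbrsP[uS vu] /nbrsP[u'S vu']] : u \in nbrs v /\ u' \in nbrs v.
  by rewrite nv set21 set22.
have /dominatingP domS := max_indep_dominating.
apply: (@secure_dom_number_le (v |: S)); last first.
  by rewrite cardsU1 vS eqS cards2; case: (u == u').
apply: secure_dominatingP => [|x].
  by apply/dominatingP => y; have [s sS ys] := domS y; exists s; rewrite // setU1r.
rewrite in_setU1 negb_or => /andP[nxv xS].
have open s : s \in S -> cadj x s -> e x s.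
  by move=> sS /orP[/eqP exs|//]; rewrite exs sS in xS.
have swap a c d f : pentagon a v c d f -> S = [set a; c] -> cadj x c ->
    cadj x a = false -> defended (v |: S) x.
  move=> Pa eqS' xc xa.
  have [aS cS] : a \in S /\ c \in S by rewrite eqS' set21 set22.
  have nac := pentagon_neq Pa.
  apply: (@defendedP _ _ c); [by rewrite setU1r | exact: open | move=> y].
  have [ya|ya] := boolP (cadj y a).
    by exists a => //; rewrite !inE aS nac !orbT.
  exists x; first exact: setU11.
  have [s] := domS y; rewrite eqS' => /set2P[] -> ys; first by rewrite ys in ya.
  exact: (pentagon_private_clique Pa ys (negbTE ya)).
case xu: (cadj x u); case xu': (cadj x u').
- have xv : cadj x v by apply: (complete_cadj2 P) => //; exact: edge_cadj.
  have {}xv : e x v by case/orP: xv => // /eqP exv; rewrite exv eqxx in nxv.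
  apply: (@defendedP _ _ v) => //; first exact: setU11.
  move=> y; have [s sS ys] := domS y; exists s => //.
  have nsv : s != v by apply: contraNneq vS => <-.
  by rewrite !inE nsv sS !orbT.
- by apply: (swap _ _ _ _ (pentagon_rev P)) => //; rewrite setUC.
- exact: (swap _ _ _ _ P).
- by have [s] := domS x; rewrite eqS => /set2P[] ->; rewrite ?xu ?xu'.
Qed.

Definition hub k v := [forall u in nbrs v, forall y, cadj y u ==> cadj y k].

Lemma hubP k v u y : hub k v -> u \in nbrs v -> cadj y u -> cadj y k.
Proof. by move=> /forall_inP h uv; move/(_ u uv)/forallP/(_ y)/implyP: h. Qed.

(** By connectivity some edge [x y] leaves the union of the closed
    neighborhoods of the two neighbors of [v].  The outer end [y] is far from
    the pentagon of [v], so [x] is complete to it and is a hub. *)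
Lemma undefended_hub v s : connected_graph e -> undefended v ->
  s \in S -> s \notin nbrs v -> exists k, hub k v.
Proof.
move=> conn undef_v sS nsv; have [u uv] := undefended_nbr undef_v.
have [u' [p' [p [P nv]]]] := undefended_pentagon undef_v uv.
have /nbrsP[uS vu] := uv.
have /nbrsP[u'S vu'] : u' \in nbrs v by rewrite nv set22.
apply/existsP; apply: contraT => /existsPn no_hub.
have clM : closed e [pred y | cadj y u || cadj y u'].
  apply: intro_closed; first exact: sym_connect_sym.
  move=> x y xy; rewrite !inE => xM; apply: contraT.
  rewrite negb_or => /andP[/negbTE yu /negbTE yu'].
  case: (far_neighbor P xy (far_from2 P yu yu')) => [[xu _ xu' _ _]|xC].
    by rewrite xu xu' in xM.
  case/negP: (no_hub x); apply/forall_inP => w; rewrite nv => wv.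
  apply/forallP => z; apply/implyP => zw; apply: (complete_dominates P xC).
  by case=> zu _ zu' _ _; case/set2P: wv zw => ->; rewrite ?zu ?zu'.
have := closed_connect clM (conn u s); rewrite !inE cadjxx /= !indep_cadj //.
by move/esym; rewrite -in_set2 -nv (negbTE nsv).
Qed.

Lemma undefended_hub_notin k v : undefended v -> hub k v -> k \notin S.
Proof.
move=> undef_v hk; have [u uv] := undefended_nbr undef_v.
have [u' [p' [p [P nv]]]] := undefended_pentagon undef_v uv.
have u'v : u' \in nbrs v by rewrite nv set22.
have /nbrsP[uS _] := uv; have /nbrsP[u'S _] := u'v.
apply/negP => kS; have := hubP hk uv (cadjxx u); have := hubP hk u'v (cadjxx u').
rewrite !indep_cadj // => /eqP u'k /eqP uk.
by have := pentagon_neq P; rewrite u'k uk eqxx.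
Qed.

(** The hubs come from a minimal set [Z] that meets the hub set of every
    undefended vertex: by minimality each [k] in [Z] is the only hub in [Z] of
    some [v], and [rep k] is one of the two neighbors of that [v] in [S]. *)
Lemma minimal_hub_system : (forall v, undefended v -> exists k, hub k v) ->
  exists (Z : {set T}) (rep : T -> T),
    (forall v, undefended v -> exists2 k, k \in Z & hub k v) /\
    (forall k, k \in Z -> exists v, [/\ undefended v, rep k \in nbrs v, hub k v &
                                       forall j, j \in Z -> hub j v -> j = k]).
Proof.
move=> hubs.
pose hits (Z : {set T}) := [forall v, undefended v ==> [exists k in Z, hub k v]].
have [Z /minsetP[hitZ minZ]] : exists Z, minset hits Z.
  suff hitT: hits setT by have [Z minZ _] := minset_exists hitT; exists Z.
  apply/forallP => v; apply/implyP => /hubs[k hk].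
  by apply/exists_inP; exists k; rewrite ?inE.
have {}hitZ v : undefended v -> exists2 k, k \in Z & hub k v.
  by move=> undef_v; apply/exists_inP; move/forallP/(_ v)/implyP: hitZ; apply.
suff [rep repP] : exists rep : T -> T, forall k, k \in Z -> exists v,
    [/\ undefended v, rep k \in nbrs v, hub k v & forall j, j \in Z -> hub j v -> j = k].
  by exists Z, rep.
apply: (@fin_all_exists _ (fun=> T) (fun k u => k \in Z -> exists v,
  [/\ undefended v, u \in nbrs v, hub k v & forall j, j \in Z -> hub j v -> j = k])).
move=> k; case: (boolP (k \in Z)) => [kZ|_]; last by exists k.
have : ~~ hits (Z :\ k).
  by apply/negP => /minZ/(_ (subD1set _ _)) eqZ; rewrite -eqZ setD11 in kZ.
case/forallPn=> v; rewrite negb_imply => /andP[undef_v /exists_inPn nohub].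
have only j : j \in Z -> hub j v -> j = k.
  by move=> jZ; apply: contraTeq => njk; apply: nohub; exact/setD1P.
have [u uv] := undefended_nbr undef_v; exists u => _; exists v; split=> //.
by have [j jZ hj] := hitZ v undef_v; rewrite -(only j).
Qed.

(** With [Z] and [rep] as above, [(S :\: rep @: Z) :|: Z] is secure
    dominating.  A vertex [x] in the closed neighborhood of the pair of an
    undefended vertex is served by a member of the pair that was kept, as a hub
    in [Z] still dominates all that this member dominated.  If no kept member
    is adjacent to [x], then the pair has lost [rep j], where [j] is its only hub in
    [Z]; then [x] is served by [j], because [x] and the other member
    dominate the closed neighborhood of [rep j] by [pentagon_private_clique],
    and any other lost [rep i] is replaced by [i], which differs from [j].  A vertex
    [x] away from all pairs is served as it was in [S]. *)
Lemma hubs_secure : (forall v, undefended v -> exists k, hub k v) ->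
  secure_dom_number e <= #|S|.
Proof.
case/minimal_hub_system=> Z [rep [hitZ repP]].
have repS k : k \in Z -> rep k \in S by case/repP=> v [_ /nbrsP[]].
have ZS k : k \in Z -> k \notin S.
  by case/repP=> v [undef_v _ hk _]; apply: undefended_hub_notin hk.
have rep_hub k y : k \in Z -> cadj y (rep k) -> cadj y k.
  by case/repP=> v [_ kv hk _]; apply: hubP kv.
have hub_eq k v w : nbrs v = nbrs w -> hub k v = hub k w by rewrite /hub => ->.
have rep_hub_eq i j v : i \in Z -> j \in Z -> undefended v -> rep i \in nbrs v ->
    rep j \in nbrs v -> i = j.
  move=> iZ jZ undef_v iv jv.
  have [w [undef_w iw hi _]] := repP i iZ; have [w' [undef_w' jw' _ only]] := repP j jZ.
  have eq_w : nbrs w = nbrs v by apply: undefended_nbrs_eq iw iv.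
  have eq_w' : nbrs w' = nbrs v by apply: undefended_nbrs_eq jw' jv.
  by apply: only => //; rewrite (hub_eq _ _ _ eq_w') -(hub_eq _ _ _ eq_w).
have rep_inj : {in Z &, injective rep}.
  move=> i j iZ jZ eqij; have [v [undef_v iv _ _]] := repP i iZ.
  by apply: (rep_hub_eq i j v); rewrite -?eqij.
pose S' := (S :\: rep @: Z) :|: Z.
have S'P s : s \in S -> s \in S' \/ exists2 k, k \in Z & s = rep k.
  move=> sS; case: (boolP (s \in rep @: Z)) => [/imsetP|sW]; first by right.
  by left; rewrite !inE sW sS.
have ZS' k : k \in Z -> k \in S' by move=> kZ; rewrite inE kZ orbT.
have /dominatingP domS := max_indep_dominating.
have domS' y : exists2 s, s \in S' & cadj y s.
  have [s sS ys] := domS y; have [sS'|[k kZ esk]] := S'P s sS; first by exists s.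
  by exists k; rewrite ?ZS' // rep_hub // -esk.
apply: (@secure_dom_number_le S'); last first.
  rewrite (leq_trans (leq_card_setU _ _)) // cardsD.
  have subS : rep @: Z \subset S.
    by apply/subsetP => _ /imsetP[k kZ ->]; apply: repS.
  rewrite (setIidPr subS).
  rewrite (card_in_imset rep_inj) subnK // -(card_in_imset rep_inj).
  exact: subset_leq_card.
apply: secure_dominatingP => [|x xS']; first exact/dominatingP.
have open s : s \in S' -> cadj x s -> e x s.
  by move=> sS /orP[/eqP exs|//]; rewrite exs sS in xS'.
case: (boolP [exists v, undefended v && [exists p in nbrs v, cadj x p]]).
  case/existsP=> v /andP[undef_v /exists_inP[p pv xp]].
  have [k kZ hk] := hitZ v undef_v.
  case: (boolP [exists q in nbrs v :&: S', cadj x q]).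
    case/exists_inP=> q /setIP[qv qS'] xq.
    apply: (@defendedP _ _ q) => //; first exact: open.
    move=> y; have [s sS' ys] := domS' y.
    have [esq|nsq] := eqVneq s q; last first.
      by exists s; rewrite // setU1r // in_setD1 nsq.
    exists k; last by apply: (hubP hk qv); rewrite -esq.
    have nkq : k != q by apply: contraNneq (ZS k kZ) => ->; case/nbrsP: qv.
    by rewrite setU1r // in_setD1 nkq ZS'.
  move=> /exists_inPn noq.
  have /nbrsP[pS vp] := pv.
  have [pS'|[j jZ epj]] := S'P p pS.
    by have := noq p; rewrite inE pv pS' xp => /(_ isT).
  have [u [p' [q [P nv]]]] := undefended_pentagon undef_v pv.
  have uv : u \in nbrs v by rewrite nv set22.
  have npu := pentagon_neq P.
  have /nbrsP[uS _] := uv.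
  have uS' : u \in S'.
    have [//|[i iZ eui]] := S'P u uS.
    have eij : i = j by apply: (rep_hub_eq i j v); rewrite -?eui -?epj.
    by rewrite epj eui eij eqxx in npu.
  have xu : cadj x u = false by apply/negbTE/noq; rewrite inE uv.
  have xj : cadj x j by apply: rep_hub => //; rewrite -epj.
  apply: (@defendedP _ _ j); [exact: ZS' | exact: open (ZS' j jZ) xj | move=> y].
  have notj s : s \in S' -> s != j -> s \in x |: (S' :\ j).
    by move=> sS' nsj; rewrite setU1r // in_setD1 nsj.
  have neqj s : s \in S -> s != j by move=> sS; apply: contraNneq (ZS j jZ) => <-.
  have [yu|yu] := boolP (cadj y u); first by exists u; rewrite ?notj ?neqj.
  have [s sS ys] := domS y; have [sS'|[i iZ esi]] := S'P s sS.
    by exists s; rewrite ?notj ?neqj.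
  have [eij|nij] := eqVneq i j; last by exists i; rewrite ?notj ?ZS' // rep_hub // -esi.
  exists x; first exact: setU11.
  apply: (pentagon_private_clique (pentagon_rev P)) => //; last exact: negbTE.
  by rewrite epj -eij -esi.
move=> /existsPn far_undef.
have not_pair p v : undefended v -> p \in nbrs v -> cadj x p = false.
  move=> undef_v pv; have := far_undef v; rewrite undef_v /= => /exists_inPn/(_ p pv).
  exact: negbTE.
have xS : x \notin S.
  apply/negP => xS; have [xS2|[k kZ exk]] := S'P x xS; first by rewrite xS2 in xS'.
  have [v [undef_v kv _ _]] := repP k kZ.
  by have := not_pair _ _ undef_v kv; rewrite -exk cadjxx.
have : ~~ undefended x.
  apply/negP => undef_x; have [u ux] := undefended_nbr undef_x.
  by have := not_pair _ _ undef_x ux; case/nbrsP: ux => _ /edge_cadj ->.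
rewrite /undefended xS negbK => /exists_inP[u uS /andP[xu /dominatingP domu]].
have uS' : u \in S'.
  have [//|[k kZ euk]] := S'P u uS; have [v [undef_v kv _ _]] := repP k kZ.
  by have := not_pair _ _ undef_v kv; rewrite -euk edge_cadj.
apply: (@defendedP _ _ u) => // y; have [s + ys] := domu y.
case/setU1P=> [esx|/setD1P[nsu sS]]; first by exists s; rewrite // esx setU11.
have [sS'|[k kZ esk]] := S'P s sS; first by exists s; rewrite // setU1r // in_setD1 nsu.
exists k; last by rewrite rep_hub // -esk.
rewrite setU1r // in_setD1 ZS' // andbT.
by apply: contraNneq (ZS k kZ) => ->.
Qed.

End SecureDomination.

Theorem theorem9 (T : finType) (e : rel T)
  (e_sym : symmetric e) (e_irr : irreflexive e)
  (e_conn : connected_graph e)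
  (P5_free : ~ has_induced e (@path_rel 5))
  (C4_free : ~ has_induced e (@cycle_rel 4)) :
  secure_dom_number e <= maxn 3 (indep_number e).
Proof.
have ind0 : 0 < #|independent e|.
  by apply/card_gt0P; exists set0; apply/forall_inP => x; rewrite inE.
have [S indS eqS] := @eq_bigmax_cond _ (independent e) (fun S : {set T} => #|S|)
  ind0.
have maxS (A : {set T}) : independent e A -> #|A| <= #|S|.
  by move=> indA; rewrite -eqS; apply: (bigmax_sup A).
rewrite leq_max /indep_number eqS.
have [/existsP[v /andP[undef_v subS]]|/existsPn nosub] :=
    boolP [exists v, undefended e S v && (S \subset nbrs e S v)].
  by rewrite (undefended_small e_sym e_irr P5_free C4_free indS maxS undef_v subS).
apply/orP; right; apply: (hubs_secure e_sym e_irr P5_free C4_free) => // v undef_v.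
have := nosub v; rewrite undef_v => /subsetPn[s sS nsv].
exact: (undefended_hub e_sym e_irr P5_free C4_free indS maxS e_conn undef_v sS nsv).
Qed.
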